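(* Let $G$ be a connected graph on $n$ vertices. Then $\hat{p}(G)=\lceil \log_2 n\rceil$ if and only if $G$ is a subgraph of the hypercube $Q_{\lceil \log_2 n\rceil}$.
   Context: An edge-coloring of a graph assigns a color to each edge. Given an edge-coloring, a walk is a parity walk if every color appears an even number of times along a traversal of the walk (counted with multiplicity); a walk is open if its two endpoints are distinct. A strong parity edge-coloring (spec) of $G$ is an edge-coloring with no open parity walk, and $\hat{p}(G)$ is the minimum number of colors in a spec of $G$. $Q_k$ denotes the $k$-dimensional hypercube, whose vertices are the binary $k$-tuples, two being adjacent when they differ in exactly one coordinate. *)

(* Defs.v *)
From mathcomp Require Import all_boot.
From mathcomp Require Import boolp.

Set Implicit Arguments.
Unset Strict Implicit.
Unset Printing Implicit Defensive.

Record sgraph := SGraph {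
  vertex :> finType;
  adj : rel vertex;
  adj_sym : symmetric adj;
  adj_irrefl : irreflexive adj }.

Arguments adj {s} : rename.

Definition connected (G : sgraph) : Prop :=
  0 < #|G| /\ forall x y : G, connect adj x y.

Definition edges (G : sgraph) : {set {set G}} :=
  [set [set uv.1; uv.2] | uv : G * G & adj uv.1 uv.2].

(* A walk is given by its first vertex x and the sequence p of the following
   ones, so that it ends at last x p; repetitions are allowed. *)
Definition walk (G : sgraph) (x : G) (p : seq G) : bool := path adj x p.

Definition open_walk (G : sgraph) (x : G) (p : seq G) : bool :=
  walk x p && (x != last x p).

Definition walk_edges (G : sgraph) (x : G) (p : seq G) : seq {set G} :=
  pairmap (fun u v => [set u; v]) x p.

(* Colors are natural numbers; the values of a coloring outside edges G are
   irrelevant, as walks only traverse edges and num_colors only sees edges. *)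
Definition edge_coloring (G : sgraph) := {set G} -> nat.

Definition num_colors (G : sgraph) (c : edge_coloring G) : nat :=
  size (undup [seq c E | E <- enum (edges G)]).

Definition parity_walk (G : sgraph) (c : edge_coloring G) (x : G) (p : seq G)
    : Prop :=
  walk x p /\ forall a : nat, ~~ odd (count_mem a (map c (walk_edges x p))).

Definition spec (G : sgraph) (c : edge_coloring G) : Prop :=
  ~ exists (x : G) (p : seq G), open_walk x p /\ parity_walk c x p.

Lemma odd_count_incident (G : sgraph) (v x : G) (p : seq G) : walk x p ->
  odd (count (fun E : {set G} => v \in E) (walk_edges x p))
    = (v == x) (+) (v == last x p).
Proof.
elim: p x => [|y p IHp] x /=; first by rewrite addbb.
case/andP=> xy /IHp IH; rewrite oddD IH oddb !inE.
have : x != y by apply: contraTneq xy => ->; rewrite adj_irrefl.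
have [-> xy'|_ _] := eqVneq v x; last by rewrite orFb addbA addbb.
by rewrite orTb (negbTE xy').
Qed.

Lemma odd_count0 (T : eqType) (a : pred T) (s : seq T) :
  (forall z, ~~ odd (count_mem z s)) -> ~~ odd (count a s).
Proof.
move=> ev; rewrite -sum1_count -big_undup_iterop_count.
elim/big_ind: _ => // [m n /negbTE em /negbTE en | z _].
  by rewrite oddD em en.
by rewrite Monoid.iteropE iter_addn addn0 mul1n ev.
Qed.

(* Giving every edge its own color is a strong parity edge-coloring. *)
Lemma spec_exists (G : sgraph) :
  exists k, `[< exists2 c : edge_coloring G, spec c & num_colors c = k >].
Proof.
pose c : edge_coloring G := fun E => enum_rank E.
exists (num_colors c); apply/asboolP; exists c => // -[x [p [/andP[w op] [_ ev]]]].
have evE (E : {set G}) : ~~ odd (count_mem E (walk_edges x p)).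
  rewrite (eq_count (a2 := preim c (pred1 (c E)))) -?count_map ?ev // => F /=.
  by rewrite /c (inj_eq val_inj) (inj_eq enum_rank_inj).
have := odd_count0 (fun E : {set G} => x \in E) evE.
by rewrite odd_count_incident // eqxx (negbTE op).
Qed.

Definition spec_number (G : sgraph) : nat := ex_minn (spec_exists G).

Definition hypercube_adj (k : nat) : rel (k.-tuple bool) :=
  fun x y => #|[set i | tnth x i != tnth y i]| == 1.

Lemma hypercube_sym (k : nat) : symmetric (@hypercube_adj k).
Proof.
move=> x y; congr (_ == _); apply: eq_card => i.
by rewrite !inE eq_sym.
Qed.

Lemma hypercube_irrefl (k : nat) : irreflexive (@hypercube_adj k).
Proof.
move=> x; apply/negbTE; rewrite /hypercube_adj.
by rewrite (eq_card0 (A := [set i | _])) // => i; rewrite !inE eqxx.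
Qed.

Definition hypercube (k : nat) : sgraph :=
  SGraph (@hypercube_sym k) (@hypercube_irrefl k).

(* Not necessarily induced, and up to isomorphism, as usual for unlabeled
   graphs. *)
Definition subgraph_of (G H : sgraph) : Prop :=
  exists2 f : G -> H, injective f & forall x y : G, adj x y -> adj (f x) (f y).

(* Main.v *)
Require Import Defs.
From mathcomp Require Import all_boot.
From mathcomp Require Import boolp.

Set Implicit Arguments.
Unset Strict Implicit.
Unset Printing Implicit Defensive.

(** Fix a strong parity edge-coloring with k colors and send each walk from a
    root r to the vector in F_2^k of the parities of its colors. Walks with the
    same vector have the same end, so the vectors of the walks from r to x form
    pairwise disjoint cosets, as x varies, of the group W of vectors of closed
    walks at r. Hence n |W| <= 2^k. For k = up_log 2 n this makes W trivial:
    the vector of a walk from r depends only on its end, which embeds G in Q_k.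
    Conversely, coloring each edge of a subgraph of Q_k by the coordinate that
    it flips gives a strong parity edge-coloring. *)

Section Parity.
Variables (G : sgraph) (c : edge_coloring G).
Implicit Types (x y : G) (p q : seq G) (a : nat).

Definition parity x p a : bool :=
  odd (count_mem a (map c (walk_edges x p))).

Lemma parity_cons x y p a :
  parity x (y :: p) a = (c [set x; y] == a) (+) parity y p a.
Proof. by rewrite /parity /= oddD oddb. Qed.

Lemma parity_cat x p q a :
  parity x (p ++ q) a = parity x p a (+) parity (last x p) q a.
Proof. by rewrite /parity /walk_edges pairmap_cat map_cat count_cat oddD. Qed.

Lemma walk_cat x p q : walk x (p ++ q) = walk x p && walk (last x p) q.
Proof. exact: cat_path. Qed.

Lemma walk_rev x p : walk x p -> exists q,
  [/\ walk (last x p) q, last (last x p) q = x &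
      parity (last x p) q =1 parity x p].
Proof.
elim: p x => [|y p IHp] x /=; first by exists [::].
case/andP=> xy /IHp[q [wq lq eq_q]]; exists (rcons q x); split.
- by rewrite -cats1 walk_cat wq lq /= adj_sym xy.
- by rewrite last_rcons.
- by move=> a; rewrite -cats1 parity_cat !parity_cons eq_q lq setUC addbF addbC.
Qed.

(** Reversing [p] and then following [q] joins the two ends by a walk on which every color is even;
    such a walk cannot be open. *)
Lemma spec_parity_last x p q : spec c -> walk x p -> walk x q ->
  parity x p =1 parity x q -> last x p = last x q.
Proof.
move=> spc wp wq eq_pq; have [s [ws ls eq_s]] := walk_rev wp.
apply/eqP; apply: contraPT spc => neq; apply; exists (last x p), (s ++ q).
have w : walk (last x p) (s ++ q) by rewrite walk_cat ws ls.
split; first by rewrite /open_walk w last_cat ls neq.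
split=> // a; rewrite -[odd _]/(parity _ _ a).
by rewrite parity_cat ls eq_s eq_pq addbb.
Qed.

Definition colors : seq nat := undup [seq c E | E <- enum (edges G)].

Lemma mem_colors x y : adj x y -> c [set x; y] \in colors.
Proof.
move=> xy; rewrite mem_undup; apply: map_f; rewrite mem_enum.
by apply/imsetP; exists (x, y); rewrite ?inE.
Qed.

Lemma parity_notin x p a : walk x p -> a \notin colors -> parity x p a = false.
Proof.
move=> wp Na; elim: p x wp => [|y p IHp] x //= /andP[xy /IHp].
rewrite parity_cons => ->; rewrite addbF.
by apply: contraNF Na => /eqP <-; apply: mem_colors.
Qed.

Definition parity_vector x p : (num_colors c).-tuple bool :=
  [tuple parity x p (nth 0 colors i) | i < num_colors c].

(** Colors outside [colors] never occur on a walk, so the finite vector determines all parities. *)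
Lemma parity_vector_inj x p y q : walk x p -> walk y q ->
  parity_vector x p = parity_vector y q -> parity x p =1 parity y q.
Proof.
move=> wp wq eq_pq a; have [ac|Na] := boolP (a \in colors); last first.
  by rewrite !parity_notin.
have lt_a : index a colors < num_colors c by rewrite index_mem.
have := congr1 (fun t => tnth t (Ordinal lt_a)) eq_pq.
by rewrite !tnth_mktuple /= nth_index.
Qed.

Lemma connected_walks r : connected G ->
  exists w : G -> seq G, forall x, walk r (w x) /\ x = last r (w x).
Proof.
case=> _ conn; suff /choice[w wP] x : exists p, walk r p /\ x = last r p.
  by exists w.
by have /connectP[p] := conn r x; exists p.
Qed.

Lemma spec_card_le : connected G -> spec c -> #|G| <= 2 ^ num_colors c.
Proof.
move=> connG spc; have /card_gt0P[r _] := connG.1.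
have [w wP] := connected_walks r connG.
rewrite -card_bool -card_tuple.
apply: (@leq_card _ _ (fun x => parity_vector r (w x))) => x y.
have [[wx {2}->] [wy {2}->]] := (wP x, wP y).
by move/(parity_vector_inj wx wy); apply: spec_parity_last.
Qed.

(** In place of the whole group W, one closed walk [z] with nonzero vector suffices: [w x] and
    [z ++ w x] give two vectors per vertex [x], all of them distinct. *)
Lemma spec_card_double_le r z : connected G -> spec c ->
  walk r z -> last r z = r -> ~ parity r z =1 (fun=> false) ->
  2 * #|G| <= 2 ^ num_colors c.
Proof.
move=> connG spc wz lz nz.
have [w wP] := connected_walks r connG.
pose v (bx : bool * G) := (if bx.1 then z else [::]) ++ w bx.2.
have vP bx : [/\ walk r (v bx), last r (v bx) = bx.2 &
    forall a,
      parity r (v bx) a = (bx.1 && parity r z a) (+) parity r (w bx.2) a].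
  case: bx => b x; have [wx lx] := wP x.
  case: b; split=> [||a]; rewrite /v /= ?walk_cat ?last_cat ?parity_cat ?lz //.
  by rewrite wz.
rewrite -card_bool -card_prod card_bool -[X in X ^ _]card_bool -card_tuple.
apply: (@leq_card _ _ (fun bx => parity_vector r (v bx))) => bx bx2 eqv.
have [wx lx px] := vP bx; have [wy ly py] := vP bx2.
have eqp := parity_vector_inj wx wy eqv.
have := spec_parity_last spc wx wy eqp; rewrite lx ly.
case: bx bx2 eqp px py {eqv wx wy lx ly} => [b x] [b' y] /= eqp px py eqxy.
subst y; congr (_, _); have [//|neq] := eqVneq b b'; case: nz => a.
(* Both walks contain the same [w x]; cancelling its parity leaves parity zero along [z] at [a]. *)
have := eqp a; rewrite px py => /addIb.
by case: b b' neq {eqp px py} => [] [].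
Qed.

Lemma spec_subgraph : connected G -> spec c -> 2 ^ num_colors c < 2 * #|G| ->
  subgraph_of G (hypercube (num_colors c)).
Proof.
move=> connG spc lt_c; have /card_gt0P[r _] := connG.1.
have [w wP] := connected_walks r connG.
(* Otherwise [p] followed by the reverse of [q] is a closed walk with nonzero vector, for which
   there is no room. *)
have parity_end p q : walk r p -> walk r q -> last r p = last r q ->
    parity r p =1 parity r q.
  move=> wp wq eq_l; apply: contrapT => neq.
  have [s [ws ls eq_s]] := walk_rev wq.
  suff: 2 * #|G| <= 2 ^ num_colors c by rewrite leqNgt lt_c.
  apply: (@spec_card_double_le r (p ++ s)) => //.
  - by rewrite walk_cat wp eq_l.
  - by rewrite last_cat eq_l.
  - move=> eq0; apply: neq => a; have := eq0 a.
    by rewrite parity_cat eq_l eq_s; do 2!case: (parity _ _ _).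
exists (fun x => parity_vector r (w x)) => [x y|x y xy].
  have [[wx {2}->] [wy {2}->]] := (wP x, wP y).
  by move/(parity_vector_inj wx wy); apply: spec_parity_last.
have [[wx lx] [wy ly]] := (wP x, wP y).
(* Extending [w x] by the edge to [y] changes only the parity of that edge's color, and yields the
   vector of [w y]. *)
have wxy : walk r (w x ++ [:: y]) by rewrite walk_cat wx -lx /= xy.
have lxy : last r (w x ++ [:: y]) = last r (w y) by rewrite last_cat -ly.
have eqp := parity_end _ _ wxy wy lxy.
have lt_i : index (c [set x; y]) colors < num_colors c.
  by rewrite index_mem mem_colors.
apply/cards1P; exists (Ordinal lt_i); apply/setP=> j.
rewrite !inE !tnth_mktuple -eqp parity_cat -lx parity_cons addbF.
rewrite negb_eqb addKb -[RHS](inj_eq val_inj) /=.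
(* As [colors] has no repetition, comparing positions amounts to comparing colors. *)
rewrite -(nth_uniq 0 (ltn_ord j) lt_i (undup_uniq _)).
by rewrite nth_index ?mem_colors // eq_sym.
Qed.

End Parity.

Section Hypercube.
Variables (G : sgraph) (k : nat) (f : G -> hypercube k).
Hypothesis f_inj : injective f.
Hypothesis f_adj : forall x y : G, adj x y -> adj (f x) (f y).

(* The default 0 is never used on an edge. *)
Definition flip_coloring : edge_coloring G := fun E =>
  if [pick i | [exists u in E, exists v in E, tnth (f u) i != tnth (f v) i]]
    is Some i then i else 0.

Lemma flip_coloringP x y : adj x y -> exists2 i : 'I_k,
  flip_coloring [set x; y] = i &
  forall j, (tnth (f x) j != tnth (f y) j) = (j == i).
Proof.
move/f_adj/cards1P=> [i /setP flip]; exists i; last first.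
  by move=> j; have := flip j; rewrite !inE.
(* The order of the ends is immaterial and [u = v] flips nothing, so the [pick] can only return
   [i]. *)
have ex_flip j : [exists u in [set x; y], exists v in [set x; y],
    tnth (f u) j != tnth (f v) j] = (j == i).
  have := flip j; rewrite !inE => <-; apply/idP/idP => [|neq].
    case/existsP=> u /andP[+ /existsP[v /andP[+]]].
    by rewrite !inE => /orP[]/eqP-> /orP[]/eqP->; rewrite ?eqxx // eq_sym.
  apply/existsP; exists x; rewrite !inE eqxx.
  by apply/existsP; exists y; rewrite !inE eqxx orbT.
rewrite /flip_coloring; case: pickP => [j|/(_ i)]; rewrite ex_flip ?eqxx //.
by move/eqP->.
Qed.

Lemma flip_num_colors : num_colors flip_coloring <= k.
Proof.
rewrite -[k in _ <= k](size_iota 0); apply: uniq_leq_size (undup_uniq _) _ => a.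
rewrite mem_undup => /mapP[E]; rewrite mem_enum => /imsetP[[x y] + ->] ->.
by rewrite inE /= => /flip_coloringP[i -> _]; rewrite mem_iota ltn_ord.
Qed.

(** Each traversal of an edge of color [i] flips coordinate [i], and no other edge changes it. *)
Lemma flip_parity x p (i : 'I_k) : walk x p ->
  parity flip_coloring x p i = tnth (f x) i (+) tnth (f (last x p)) i.
Proof.
elim: p x => [|y p IHp] x /=; first by rewrite addbb.
case/andP=> xy /IHp; rewrite parity_cons => ->.
have [j -> flip] := flip_coloringP xy.
by rewrite (inj_eq val_inj) eq_sym -flip negb_eqb addbA addbK.
Qed.

Lemma flip_spec : spec flip_coloring.
Proof.
case=> x [p [/andP[wp /eqP neq] [_ ev]]]; apply/neq/f_inj/eq_from_tnth => i.
have := ev i; rewrite -[odd _]/(parity _ _ _ i) flip_parity //.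
by rewrite -negb_eqb negbK => /eqP.
Qed.

End Hypercube.

Lemma spec_number_le (G : sgraph) (c : edge_coloring G) :
  spec c -> spec_number G <= num_colors c.
Proof.
move=> spc; rewrite /spec_number; case: ex_minnP => m _; apply.
by apply/asboolP; exists c.
Qed.

Lemma spec_number_attained (G : sgraph) :
  exists2 c : edge_coloring G, spec c & num_colors c = spec_number G.
Proof. by rewrite /spec_number; case: ex_minnP => m /asboolP. Qed.

Lemma expn_up_log_lt n : 0 < n -> 2 ^ up_log 2 n < 2 * n.
Proof.
(* For n at least 2, minimality gives [2 ^ (up_log 2 n).-1 < n], which is then doubled; n = 1 is
   computed. *)
case: n => [|[|n]] // _; have := @up_log_gtn 2 n.+2 isT isT.
have: 0 < up_log 2 n.+2 by rewrite up_log_gt0.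
by case: (up_log _ _) => // m _ /=; rewrite expnS ltn_pmul2l.
Qed.

Theorem theorem1p3 (G : sgraph) (n : nat) (connG : connected G)
    (cardG : #|G| = n) :
  spec_number G = up_log 2 n <-> subgraph_of G (hypercube (up_log 2 n)).
Proof.
have [c spc cN] := spec_number_attained G; split=> [eqN|[f f_inj f_adj]].
  rewrite -eqN -cN; apply: spec_subgraph => //.
  by rewrite cN eqN cardG expn_up_log_lt // -cardG connG.1.
apply/eqP; rewrite eqn_leq; apply/andP; split.
  apply: leq_trans (flip_num_colors f_adj).
  exact: spec_number_le (flip_spec f_inj f_adj).
(* A spec with m colors forces [n <= 2 ^ m], and [up_log 2 n] is the least such exponent. *)
by rewrite -cN up_log_min // -cardG spec_card_le.
Qed.
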